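(* Consider the multilevel eigenvalue iteration scheme on nested spaces $V_{h_1}\subset\cdots\subset V_{h_n}$, either for the first eigenpair or for the first $m$ eigenpairs (both defined in the context), and let $N_k=\dim V_{h_k}$. Assume that solving the eigenvalue problem in the coarse space $V_{h_1}$ needs work $\mathcal{O}(M_{h_1})$, and that for each $k=2,\dots,n$ the work for solving the augmented linear problem in $V_{h_k}$ is only $\mathcal{O}(N_k)$ (in the case of $m>1$ eigenpairs, the $m$ augmented linear problems are solved in parallel, one for each $i=1,\dots,m$, and the work is counted per computing node). Then the total work involved in the scheme is $\mathcal{O}(N_n+M_{h_1})$. Furthermore, the complexity is $\mathcal{O}(N_n)$ provided $M_{h_1}\le N_n$. Here the $\mathcal{O}$-constants are independent of the level $k$ and of $n$.
   Context: $\Omega\subset\mathbb{R}^d$ ($d=2,3$) is a bounded domain, $V=H_0^1(\Omega)$, $a(u,v)=\int_\Omega\nabla u\cdot\nabla v\,d\Omega$, $b(u,v)=\int_\Omega uv\,d\Omega$, $\|v\|_b^2=b(v,v)$. The eigenvalue problem is: find $(\lambda,u)\in\mathbb{R}\times V$ with $b(u,u)=1$ and $a(u,v)=\lambda b(u,v)$ for all $v\in V$. Meshes: $\mathcal{T}_{h_k}$ is obtained from $\mathcal{T}_{h_{k-1}}$ by regular refinement (each element is divided into $\beta^d$ subelements), $h_k=h_{k-1}/\beta$ with an integer $\beta\ge2$; $V_{h_k}\subset V$ is the linear finite element space on $\mathcal{T}_{h_k}$, so that the spaces are nested and, with constants independent of $k$ and $n$, $$N_k\approx\Big(\frac1\beta\Big)^{d(n-k)}N_n,\qquad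 k=1,\dots,n$$ ($x\approx y$ means $cx\le y\le Cx$ with constants $c,C>0$). Scheme for one eigenpair. (i) Solve the discrete eigenvalue problem in $V_{h_1}$ to get $(\lambda_{1,h_1},u_{1,h_1})$ with $b(u_{1,h_1},u_{1,h_1})=1$. (ii) For $k=1,\dots,n-1$: solve the augmented linear problem of finding $(\widehat\lambda,\widehat u)\in\mathbb{R}\times V_{h_{k+1}}$ with $a(\widehat u,v)-\lambda_{1,h_k}b(\widehat u,v)-\widehat\lambda\, b(u_{1,h_k},v)=-\lambda_{1,h_k}b(u_{1,h_k},v)$ for all $v\in V_{h_{k+1}}$ and $b(\widehat u,u_{1,h_k})=b(u_{1,h_k},u_{1,h_k})$; then set $u_{1,h_{k+1}}=\widehat u/\|\widehat u\|_b$ and $\lambda_{1,h_{k+1}}=a(u_{1,h_{k+1}},u_{1,h_{k+1}})/b(u_{1,h_{k+1}},u_{1,h_{k+1}})$. Scheme for $m$ eigenpairs ($m$ fixed). (i) Solve the discrete eigenvalue problem in $V_{h_1}$ for the first $m$ eigenpairs $(\lambda_{i,h_1},u_{i,h_1})$. (ii) For $k=1,\dots,n-1$: for each $i=1,\dots,m$ solve the augmented linear problem of finding $(x_i,\widetilde u_i)\in\mathbb{R}^m\times V_{h_{k+1}}$ with $a(\widetilde u_i,v)-\lambda_{i,h_k}b(\widetilde u_i,v)-\sum_{s=1}^m x_{si}b(u_{s,h_k},v)=-\lambda_{i,h_k}b(u_{i,h_k},v)$ for all $v\in V_{h_{k+1}}$ (where $x_{si}$ is the $s$-th component of $x_i$)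 and $b(\widetilde u_i,u_{j,h_k})=\delta_{ij}$ for $j=1,\dots,m$; then solve the $m$-dimensional eigenvalue problem for $a,b$ on $\mathrm{span}\{\widetilde u_1,\dots,\widetilde u_m\}$ to obtain the new pairs $(\lambda_{i,h_{k+1}},u_{i,h_{k+1}})$, $i=1,\dots,m$, with $b(u_{i,h_{k+1}},u_{i,h_{k+1}})=1$. Work convention: the total work is $\sum_{k=1}^n W_k$, where $W_1$ is the work of step (i) and $W_k$, $k\ge2$, is the work of the iteration step carried out in $V_{h_k}$; the operations of such a step other than solving the augmented linear problem (normalization, Rayleigh quotient, or the $m$-dimensional eigenvalue problem) cost $\mathcal{O}(N_k)$, so that $W_k=\mathcal{O}(N_k)$ when the augmented linear problem is solved with work $\mathcal{O}(N_k)$. *)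

(* Defs.v *)
From HB Require Import structures.
From mathcomp Require Import all_boot all_order all_algebra.
From mathcomp Require Import all_classical all_reals all_analysis.

Set Implicit Arguments.
Unset Strict Implicit.
Unset Printing Implicit Defensive.

Import Order.TTheory GRing.Theory Num.Theory.
Import numFieldNormedType.Exports.

Local Open Scope classical_set_scope.
Local Open Scope ring_scope.

(** * Lebesgue measure on R^d

    The library has Lebesgue measure on R only. On R^d it is obtained here as
    the Caratheodory restriction of the outer measure
    X |-> inf { sum_k vol (A k) | X is covered by the A k }, where vol A is the
    least volume of a box enclosing A (so the A k may be taken to be boxes). *)

Section lebesgue_Rd.
Context (R : realType) (d : nat).

Definition box (p q : 'rV[R]_d) : set 'rV[R]_d :=
  [set x | forall i, p 0 i < x 0 i < q 0 i].

(* The case distinction only matters for d = 0, where every box has volume 1. *)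
Definition enclosing_vol (A : set (g_sigma_algebraType (@open 'rV[R]_d))) :
    \bar R :=
  if `[< A = set0 >] then 0%E else
  ereal_inf [set (\prod_(i < d) (pq.2 0 i - pq.1 0 i))%:E | pq in
    [set pq : 'rV[R]_d * 'rV[R]_d |
      (forall i, pq.1 0 i <= pq.2 0 i) /\ A `<=` box pq.1 pq.2]].

Lemma enclosing_vol0 : enclosing_vol set0 = 0%E.
Proof. by rewrite /enclosing_vol; case: asboolP. Qed.

Lemma enclosing_vol_ge0 A : (0 <= enclosing_vol A)%E.
Proof.
rewrite /enclosing_vol; case: asboolP => // _.
apply: le_ereal_inf_tmp => _ /= [[p q] /= [pq _] <-].
by rewrite lee_fin; apply: prodr_ge0 => i _; rewrite subr_ge0.
Qed.

Definition lebesgue_outer : set 'rV[R]_d -> \bar R := mu_ext enclosing_vol.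

HB.instance Definition _ := isOuterMeasure.Build R 'rV[R]_d lebesgue_outer
  (mu_ext0 enclosing_vol0 enclosing_vol_ge0)
  (mu_ext_ge0 enclosing_vol_ge0)
  (le_mu_ext enclosing_vol)
  (mu_ext_sigma_subadditive enclosing_vol_ge0).

Definition lebesgue_om : {outer_measure set 'rV[R]_d -> \bar R} :=
  lebesgue_outer.

Definition lebRd := caratheodory_type (OuterMeasure.sort lebesgue_om).
HB.instance Definition _ := Measurable.on lebRd.

Definition leb : {measure set lebRd -> \bar R} :=
  (OuterMeasure.sort lebesgue_om : set lebRd -> \bar R).

End lebesgue_Rd.

Section sobolev.
Context (R : realType) (d : nat).
Implicit Types (Omega : set 'rV[R]_d) (u v phi : 'rV[R]_d -> R)
  (g : 'I_d -> 'rV[R]_d -> R).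

Definition bounded_domain Omega :=
  [/\ Omega !=set0, open Omega, connected Omega & bounded_set Omega].

Definition intO Omega u : R := \int[@leb R d]_(x in (Omega : set (lebRd R d))) u x.

Definition L2 Omega u :=
  measurable_fun (Omega : set (lebRd R d)) (u : lebRd R d -> R) /\
  (\int[@leb R d]_(x in (Omega : set (lebRd R d))) ((u x) ^+ 2)%:E < +oo)%E.

Definition partial (i : 'I_d) u : 'rV[R]_d -> R :=
  fun x => 'D_(delta_mx 0 i : 'rV[R]_d) u x.

Fixpoint Ck (k : nat) u : Prop :=
  continuous u /\
  if k is k'.+1 then
    forall i, (forall x, derivable u x (delta_mx 0 i)) /\ Ck k' (partial i u)
  else True.

Definition test_function Omega phi :=
  (forall k, Ck k phi) /\
  exists2 S : set 'rV[R]_d, compact S /\ S `<=` Omega &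
    forall x, ~ S x -> phi x = 0.

Definition is_weak_grad Omega u g :=
  forall phi i, test_function Omega phi ->
    intO Omega (u \* partial i phi) = - intO Omega (g i \* phi).

Definition H01 Omega u :=
  exists g, [/\ L2 Omega u, forall i, L2 Omega (g i), is_weak_grad Omega u g &
    exists2 phi : nat -> 'rV[R]_d -> R, forall j, test_function Omega (phi j) &
      (fun j => intO Omega (fun x => (u x - phi j x) ^+ 2) +
         \sum_(i < d) intO Omega (fun x => (g i x - partial i (phi j) x) ^+ 2))
        @ \oo --> (0 : R)].

(* unique almost everywhere on Omega when it exists *)
Definition wgrad Omega u : 'I_d -> 'rV[R]_d -> R :=
  xget (fun _ _ => 0)
    [set g | (forall i, L2 Omega (g i)) /\ is_weak_grad Omega u g].

Definition aform Omega u v : R :=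
  intO Omega (fun x => \sum_(i < d) wgrad Omega u i x * wgrad Omega v i x).

Definition bform Omega u v : R := intO Omega (u \* v).

Definition bnorm Omega u : R := Num.sqrt (bform Omega u u).

End sobolev.

Section finite_elements.
Context (R : realType) (d : nat).
Implicit Types (Omega : set 'rV[R]_d) (K L : 'M[R]_(d.+1, d)).

(** A simplex (triangle, tetrahedron) is given by the matrix whose rows are its
    vertices. *)
Definition nondegenerate K := row_free (row_mx K (const_mx 1 : 'cV[R]_d.+1)).

Definition barycentric (t : 'rV[R]_d.+1) :=
  (forall i, 0 <= t 0 i) /\ \sum_i t 0 i = 1.

Definition simplex K : set 'rV[R]_d :=
  [set x | exists2 t, barycentric t & x = t *m K].

(* convex hull of the common vertices of K and L; empty if there are none *)
Definition common_face K L : set 'rV[R]_d :=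
  [set x | exists t, [/\ barycentric t, x = t *m K &
     forall i, t 0 i != 0 -> exists j, row i K = row j L]].

Definition mesh := seq 'M[R]_(d.+1, d).

Definition is_mesh Omega (T : mesh) :=
  [/\ uniq T,
      forall K, K \in T -> nondegenerate K,
      closure Omega = \bigcup_(K in [set` T]) simplex K &
      forall K L, K \in T -> L \in T -> K != L ->
        interior (simplex K) `&` interior (simplex L) = set0 /\
        simplex K `&` simplex L = common_face K L].

Definition enorm (x : 'rV[R]_d) : R := Num.sqrt (\sum_i x 0 i ^+ 2).

Definition diam (A : set 'rV[R]_d) : R :=
  sup [set r | exists x y, [/\ A x, A y & r = enorm (x - y)]].

Definition mesh_size (T : mesh) : R :=
  \big[Num.max/0]_(K <- T) diam (simplex K).

Definition subelements (T' : mesh) K : mesh :=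
  [seq L <- T' | `[< simplex L `<=` simplex K >]].

Definition regular_refinement (beta : nat) (T T' : mesh) :=
  [/\ forall K, K \in T -> size (subelements T' K) = (beta ^ d)%N /\
        simplex K = \bigcup_(L in [set` subelements T' K]) simplex L,
      forall L, L \in T' -> exists2 K, K \in T & simplex L `<=` simplex K &
      mesh_size T' = mesh_size T / beta%:R].

(* T k is the mesh with parameter h_k, for k = 1, ..., n. *)
Definition mesh_hierarchy Omega (beta n : nat) (T : nat -> mesh) :=
  (forall k, (1 <= k <= n)%N -> is_mesh Omega (T k)) /\
  (forall k, (1 <= k < n)%N -> regular_refinement beta (T k) (T k.+1)).

Definition affine_on (A : set 'rV[R]_d) (v : 'rV[R]_d -> R) :=
  exists (p : 'rV[R]_d) (q : R), forall x, A x -> v x = \sum_i p 0 i * x 0 i + q.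

(* The elements of H01 are functions, not classes: taking them continuous and
   extended by zero outside Omega selects one representative of each class. *)
Definition fe_space Omega (T : mesh) : set ('rV[R]_d -> R) :=
  [set v | [/\ H01 Omega v, continuous v, forall x, ~ Omega x -> v x = 0 &
     forall K, K \in T -> affine_on (simplex K) v]].

Lemma fe_space_nested Omega beta T T' :
  regular_refinement beta T T' -> fe_space Omega T `<=` fe_space Omega T'.
Proof.
move=> [_ sub _] v [Hv cv v0 affv]; split=> // L /sub[K KT LK].
have [p [q vE]] := affv _ KT.
by exists p, q => x /LK; exact: vE.
Qed.

End finite_elements.

Section scheme.
Context (R : realType) (d : nat).
Implicit Types (Omega : set 'rV[R]_d) (W : set ('rV[R]_d -> R)).

Definition lincomb m (c : 'rV[R]_m) (w : 'I_m -> 'rV[R]_d -> R) :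
    'rV[R]_d -> R :=
  fun x => \sum_i c 0 i * w i x.

Definition fspan m (w : 'I_m -> 'rV[R]_d -> R) : set ('rV[R]_d -> R) :=
  range (fun c => lincomb c w).

Definition is_basis m (w : 'I_m -> 'rV[R]_d -> R) W :=
  W = fspan w /\ forall c, lincomb c w = (fun=> 0) -> c = 0.

Definition has_dim W m := exists w : 'I_m -> 'rV[R]_d -> R, is_basis w W.

Definition eigenpair Omega W (lam : R) (u : 'rV[R]_d -> R) :=
  [/\ W u, bform Omega u u = 1 &
      forall v, W v -> aform Omega u v = lam * bform Omega u v].

(* (lam i, u i), i < m, are the first m eigenpairs on W: the eigenvalues are
   numbered in nondecreasing order, repeated according to multiplicity. *)
Definition first_eigenpairs Omega W m (lam : 'I_m -> R)
    (u : 'I_m -> 'rV[R]_d -> R) :=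
  exists (p : nat) (mu : 'I_p -> R) (w : 'I_p -> 'rV[R]_d -> R) (mp : (m <= p)%N),
    [/\ is_basis w W,
        forall i, eigenpair Omega W (mu i) (w i),
        forall i j : 'I_p, (i <= j)%N -> mu i <= mu j &
        forall i, lam i = mu (widen_ord mp i) /\ u i = w (widen_ord mp i)].

(* (lamh, uh) solves the augmented problem in W built on the pair (lam, u). *)
Definition augmented1 Omega W lam u lamh uh :=
  [/\ W uh,
      forall v, W v ->
        aform Omega uh v - lam * bform Omega uh v - lamh * bform Omega u v
        = - lam * bform Omega u v &
      bform Omega uh u = bform Omega u u].

Definition augmentedm Omega W m (lam : 'I_m -> R) (u : 'I_m -> 'rV[R]_d -> R)
    (i : 'I_m) (x : 'I_m -> R) (ut : 'rV[R]_d -> R) :=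
  [/\ W ut,
      forall v, W v ->
        aform Omega ut v - lam i * bform Omega ut v
          - \sum_s x s * bform Omega (u s) v
        = - lam i * bform Omega (u i) v &
      forall j, bform Omega ut (u j) = (i == j)%:R].

(** A run of the scheme on spaces W 1, ..., W n, annotated with the work it
    spends. Index k >= 2 refers to the step carried out in W k: [aug_work] is
    the work for the augmented problem and [post_work] that of the remaining
    operations of the step. *)
Record one_run Omega (W : nat -> set ('rV[R]_d -> R)) (n : nat) := OneRun {
  run1_lam : nat -> R;
  run1_u : nat -> 'rV[R]_d -> R;
  run1_lamh : nat -> R;
  run1_uh : nat -> 'rV[R]_d -> R;
  run1_coarse : first_eigenpairs Omega (W 1%N)
    (fun _ : 'I_1 => run1_lam 1%N) (fun _ : 'I_1 => run1_u 1%N);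
  run1_step : forall k, (1 <= k < n)%N ->
    [/\ augmented1 Omega (W k.+1) (run1_lam k) (run1_u k)
          (run1_lamh k.+1) (run1_uh k.+1),
        run1_u k.+1 =
          (fun x => run1_uh k.+1 x / bnorm Omega (run1_uh k.+1)) &
        run1_lam k.+1 = aform Omega (run1_u k.+1) (run1_u k.+1)
                        / bform Omega (run1_u k.+1) (run1_u k.+1)];
  run1_coarse_work : R;
  run1_aug_work : nat -> R;
  run1_post_work : nat -> R;
  run1_work_ge0 : [/\ 0 <= run1_coarse_work, forall k, 0 <= run1_aug_work k &
                      forall k, 0 <= run1_post_work k]
}.

(* runm_x k i s is the coefficient x_{si} of the i-th augmented problem in W k,
   and runm_aug_work k i is the work of computing node i on that problem. *)
Record multi_run (m : nat) Omega (W : nat -> set ('rV[R]_d -> R)) (n : nat) :=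
MultiRun {
  runm_lam : nat -> 'I_m -> R;
  runm_u : nat -> 'I_m -> 'rV[R]_d -> R;
  runm_x : nat -> 'I_m -> 'I_m -> R;
  runm_ut : nat -> 'I_m -> 'rV[R]_d -> R;
  runm_coarse : first_eigenpairs Omega (W 1%N) (runm_lam 1%N) (runm_u 1%N);
  runm_step : forall k, (1 <= k < n)%N ->
    (forall i, augmentedm Omega (W k.+1) (runm_lam k) (runm_u k) i
                 (runm_x k.+1 i) (runm_ut k.+1 i)) /\
    first_eigenpairs Omega (fspan (runm_ut k.+1)) (runm_lam k.+1) (runm_u k.+1);
  runm_coarse_work : R;
  runm_aug_work : nat -> 'I_m -> R;
  runm_post_work : nat -> R;
  runm_work_ge0 : [/\ 0 <= runm_coarse_work,
                      forall k i, 0 <= runm_aug_work k i &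
                      forall k, 0 <= runm_post_work k]
}.

Definition total_work (n : nat) (level_work : nat -> R) : R :=
  \sum_(1 <= k < n.+1) level_work k.

Definition run1_level_work Omega (W : nat -> set ('rV[R]_d -> R)) n
    (r : one_run Omega W n) (k : nat) : R :=
  if k == 1%N then run1_coarse_work r else run1_aug_work r k + run1_post_work r k.

(* The m augmented problems run in parallel: the step takes the work of the
   busiest node. *)
Definition runm_level_work m Omega (W : nat -> set ('rV[R]_d -> R)) n
    (r : multi_run m Omega W n) (k : nat) : R :=
  if k == 1%N then runm_coarse_work r
  else \big[Num.max/0]_(i < m) runm_aug_work r k i + runm_post_work r k.

End scheme.

(* Main.v *)
(* Up to constants, N k is beta ^ (d (n - k)) times smaller than N n, and
   beta ^ d >= 2. So the work of the levels k >= 2 is dominated by a geometric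
   series of ratio 1/2 with last term of order N n, whose sum is at most twice
   that term. *)
Require Import Defs.
From mathcomp Require Import all_boot all_order all_algebra.
From mathcomp Require Import all_classical all_reals all_analysis.
From mathcomp Require Import lra.

Set Implicit Arguments.
Unset Strict Implicit.
Unset Printing Implicit Defensive.

Import Order.TTheory GRing.Theory Num.Theory.
Import numFieldNormedType.Exports.

Local Open Scope classical_set_scope.
Local Open Scope ring_scope.

(** Passing from [p] to [p.+1] halves every earlier term and adds a last term 1; the bound 2 is the
    fixed point of s = s/2 + 1. *)
Lemma geometric_level_sum (R : realType) (p : nat) :
  \sum_(2 <= k < p.+2) 2^-1 ^+ (p.+1 - k) <= 2 :> R.
Proof.
elim: p => [|p IHp]; first by rewrite big_geq.
rewrite big_nat_recr //= subnn expr0.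
rewrite (eq_big_nat _ _ (F2 := fun k => 2^-1 * 2^-1 ^+ (p.+1 - k))).
  by rewrite -mulr_sumr; lra.
by move=> k /andP[_ kp]; rewrite subSn // exprS.
Qed.

(** Level 1 is split off because its work is measured by the coarse eigenvalue solve. For the other
    levels, [b] bounds the work on the finest one. *)
Lemma total_work_le (R : realType) (n : nat) (w : nat -> R) (a b : R) :
  (1 <= n)%N -> 0 <= b -> w 1%N <= a ->
  (forall k, (2 <= k <= n)%N -> w k <= b * 2^-1 ^+ (n - k)) ->
  total_work n w <= a + 2 * b.
Proof.
case: n => [//|p] _ b0 wa wb; rewrite /total_work big_ltn //; apply: lerD => //.
rewrite mulrC; apply: le_trans (ler_wpM2l b0 (geometric_level_sum R p)).
by rewrite mulr_sumr; apply: ler_sum_nat => k kp; exact: wb.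
Qed.

(** Since 1/[beta] is at most 1, raising the exponent from [j] to [d * j] only shrinks the power;
    then 1/[beta] is compared with 1/2. *)
Lemma dim_decay (R : realType) (d beta j : nat) :
  (0 < d)%N -> (2 <= beta)%N ->
  (beta%:R^-1 : R) ^+ (d * j) <= 2^-1 ^+ j.
Proof.
move=> d0 b2; have qge0 : 0 <= (beta%:R^-1 : R) by rewrite invr_ge0.
have qle : (beta%:R^-1 : R) <= 2^-1.
  by rewrite lef_pV2 ?posrE ?ltr0n ?ler_nat // (leq_trans _ b2).
have qle1 : (beta%:R^-1 : R) <= 1 by lra.
apply: le_trans (lerXn2r j _ _ qle); rewrite ?nnegrE //.
by apply: ler_wiXn2l => //; rewrite leq_pmull.
Qed.

(** Stated for an arbitrary level work [w], so that both schemes become instances. In the constant,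
    2 comes from the geometric series. *)
Lemma scheme_work_le (R : realType) (d beta n : nat) (N : nat -> nat)
    (Cdim Ceig Cstep M : R) (w : nat -> R) :
  (0 < d)%N -> (2 <= beta)%N -> (1 <= n)%N ->
  0 <= Cdim -> 0 <= Ceig -> 0 <= Cstep -> 0 <= M ->
  (forall k, (1 <= k <= n)%N ->
     (N k)%:R <= Cdim * (beta%:R^-1 ^+ (d * (n - k)) * (N n)%:R)) ->
  w 1%N <= Ceig * M ->
  (forall k, (2 <= k <= n)%N -> w k <= Cstep * (N k)%:R) ->
  total_work n w <= (Ceig + 2 * (Cstep * Cdim)) * ((N n)%:R + M) /\
  (M <= (N n)%:R ->
     total_work n w <= (Ceig + 2 * (Cstep * Cdim)) * (N n)%:R).
Proof.
move=> d0 b2 n1 Cdim0 Ceig0 Cstep0 M0 hN w1 wk.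
have N0 : 0 <= (N n)%:R :> R by [].
have CC0 : 0 <= Cstep * Cdim by exact: mulr_ge0.
have tw : total_work n w <= Ceig * M + 2 * (Cstep * Cdim * (N n)%:R).
  apply: total_work_le => //; first exact: mulr_ge0.
  move=> k /andP[k2 kn]; apply: le_trans (wk k _) _; first by rewrite k2.
  rewrite -!mulrA ler_wpM2l //; apply: le_trans (hN k _) _.
    by rewrite (ltnW k2).
  by rewrite ler_wpM2l // mulrC ler_wpM2l // dim_decay.
split=> [|MN]; apply: le_trans tw _.
  (* Expanding the claimed bound leaves the nonnegative surplus
     [Ceig * N n + 2 * (Cstep * Cdim) * M]. *)
  have := mulr_ge0 Ceig0 N0; have := mulr_ge0 CC0 M0; lra.
have := ler_wpM2l Ceig0 MN; lra.
Qed.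

Theorem theorem5p1 (R : realType) (d : nat) (hd : d = 2%N \/ d = 3%N)
    (Omega : set 'rV[R]_d) (hOmega : bounded_domain Omega)
    (beta : nat) (hbeta : (2 <= beta)%N)
    (m : nat) (hm : (1 <= m)%N)
    (cdim Cdim Ceig Caug Cpost : R)
    (hcdim : 0 < cdim) (hCdim : 0 < Cdim)
    (hCeig : 0 < Ceig) (hCaug : 0 < Caug) (hCpost : 0 < Cpost) :
  exists2 C : R, 0 < C &
  forall (n : nat) (T : nat -> mesh R d) (N : nat -> nat) (M : R),
    (1 <= n)%N ->
    mesh_hierarchy Omega beta n T ->
    (forall k, (1 <= k <= n)%N -> has_dim (fe_space Omega (T k)) (N k)) ->
    (forall k, (1 <= k <= n)%N ->
       cdim * (beta%:R^-1 ^+ (d * (n - k)) * (N n)%:R) <= (N k)%:R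
         <= Cdim * (beta%:R^-1 ^+ (d * (n - k)) * (N n)%:R)) ->
    0 <= M ->
    (forall r : one_run Omega (fun k => fe_space Omega (T k)) n,
       run1_coarse_work r <= Ceig * M ->
       (forall k, (2 <= k <= n)%N -> run1_aug_work r k <= Caug * (N k)%:R) ->
       (forall k, (2 <= k <= n)%N -> run1_post_work r k <= Cpost * (N k)%:R) ->
       total_work n (run1_level_work r) <= C * ((N n)%:R + M) /\
       (M <= (N n)%:R -> total_work n (run1_level_work r) <= C * (N n)%:R))
    /\
    (forall r : multi_run m Omega (fun k => fe_space Omega (T k)) n,
       runm_coarse_work r <= Ceig * M ->
       (forall k i, (2 <= k <= n)%N -> runm_aug_work r k i <= Caug * (N k)%:R) ->
       (forall k, (2 <= k <= n)%N -> runm_post_work r k <= Cpost * (N k)%:R) ->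
       total_work n (runm_level_work r) <= C * ((N n)%:R + M) /\
       (M <= (N n)%:R -> total_work n (runm_level_work r) <= C * (N n)%:R)).
Proof.
have d0 : (0 < d)%N by case: hd => ->.
have Cstep0 : 0 < Caug + Cpost by exact: addr_gt0.
(* One step on level [k] costs at most [(Caug + Cpost) * N k] in either scheme, so one constant,
   fixed before [n] and the meshes, serves both. *)
exists (Ceig + 2 * ((Caug + Cpost) * Cdim)).
  by rewrite addr_gt0 // !mulr_gt0.
move=> n T N M n1 _ _ hN M0.
have hN' k : (1 <= k <= n)%N ->
    (N k)%:R <= Cdim * (beta%:R^-1 ^+ (d * (n - k)) * (N n)%:R).
  by move=> /hN /andP[].
split=> r w1 waug wpost.
  apply: (scheme_work_le d0 hbeta n1 (ltW hCdim) (ltW hCeig) (ltW Cstep0) M0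
    hN') => // k kn.
  rewrite /run1_level_work ifF; last by case: k kn => [|[]].
  by rewrite mulrDl lerD ?waug ?wpost.
apply: (scheme_work_le d0 hbeta n1 (ltW hCdim) (ltW hCeig) (ltW Cstep0) M0
    hN') => // k kn.
rewrite /runm_level_work ifF; last by case: k kn => [|[]].
(* The busiest node obeys the bound common to all nodes, so no factor [m] appears. The default 0 of
   the maximum asks for [Caug * N k] to be nonnegative. *)
rewrite mulrDl lerD ?wpost //; apply: bigmax_le => [|i _]; last exact: waug.
by rewrite mulr_ge0 // ltW.
Qed.
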